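(* Let $1\le \ell\le m$ be integers, let $k=\binom{m}{\ell}$ and $\nu:=\binom{m-1}{\ell-1}$. Given $\Lambda\subseteq I_\ell[m]$, consider the complement $\Lambda^{c}:=I_\ell[m]\setminus\Lambda$. Then $\Lambda$ is a subclose family in $I_\ell[m]$ if and only if $\Lambda^{c}$ is a subclose family in $I_\ell[m]$. Moreover, with $r:=|\Lambda|$, $$K_{\Lambda^c}=m\binom{\nu}{2}-r\ell(\nu-1)+K_\Lambda.$$ Consequently, $$K_{k-r}(\ell,m)=m\binom{\nu}{2}-r\ell(\nu-1)+K_r(\ell,m)\quad\text{for } 0\le r\le k.$$
   Context: $[m]:=\{1,\dots,m\}$, and $I_\ell[m]$ denotes the set of all subsets of $[m]$ of cardinality $\ell$. For $\Lambda=\{A_1,\dots,A_r\}\subseteq I_\ell[m]$ with $|\Lambda|=r$ (the $A_i$ distinct), put $K_\Lambda:=\sum_{1\le i<j\le r}|A_i\cap A_j|$. For an integer $0\le r\le k=\binom{m}{\ell}$, put $K_r(\ell,m):=\max\{K_\Lambda : \Lambda\subseteq I_\ell[m],\ |\Lambda|=r\}$. A family $\Lambda\subseteq I_\ell[m]$ is called subclose if $K_\Lambda=K_r(\ell,m)$, where $r=|\Lambda|$. *)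

(* Defs.v *)
From HB Require Import structures.
From mathcomp Require Import all_boot all_order all_algebra.

Set Implicit Arguments.
Unset Strict Implicit.
Unset Printing Implicit Defensive.

(* The ground set {1, ..., m} is represented by 'I_m = {0, ..., m - 1}. *)
Definition Iset (l m : nat) : {set {set 'I_m}} :=
  [set A : {set 'I_m} | #|A| == l].

(* A_1, ..., A_r is the enumeration enum_val of L; the value does not depend on
   the order of the enumeration. *)
Definition Kfam (m : nat) (L : {set {set 'I_m}}) : nat :=
  \sum_(i < #|L|) \sum_(j < #|L| | i < j) #|enum_val i :&: enum_val j|.

(* For r <= 'C(m, l) the index set of this maximum is nonempty, so the default
   value 0 of \max plays no role. *)
Definition Kmax (l m r : nat) : nat :=
  \max_(L : {set {set 'I_m}} | (L \subset Iset l m) && (#|L| == r)) Kfam L.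

Definition subclose (l m : nat) (L : {set {set 'I_m}}) : Prop :=
  L \subset Iset l m /\ Kfam L = Kmax l m #|L|.

(* Main.v *)
(** Let [d_x] be the number of members of [L] containing the point [x]. Double
    counting gives [K_L = \sum_x 'C(d_x, 2)] and [\sum_x d_x = r l]. Since each
    point lies in exactly [nu] sets of [I_l[m]], passing to the complement
    replaces [d_x] by [nu - d_x], and
    ['C(nu - d, 2) = 'C(nu, 2) - d (nu - 1) + 'C(d, 2)]. So [K_L] and [K_{L^c}]
    differ by a constant depending only on [r], whence the statements about
    maxima. *)
Require Import Defs.
From mathcomp Require Import all_boot all_order all_algebra.
From mathcomp Require Import zify.

Set Implicit Arguments.
Unset Strict Implicit.
Unset Printing Implicit Defensive.

Import GRing.Theory.

Definition deg (T : finType) (L : {set {set T}}) (x : T) : nat :=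
  \sum_(A in L) (x \in A).

Lemma sum_card_deg (T : finType) (L : {set {set T}}) :
  \sum_(A in L) #|A| = \sum_x deg L x.
Proof.
rewrite exchange_big; apply: eq_bigr => A _ /=.
by rewrite -sum1_card big_mkcond; apply: eq_bigr => x _; case: (x \in A).
Qed.

(** Both sides count the triples [(A, B, x)] with [x] in [A] and in [B], by pairs of sets or by
    points. *)
Lemma sum_cardI_deg (T : finType) (L : {set {set T}}) :
  \sum_(A in L) \sum_(B in L) #|A :&: B| = \sum_x deg L x * deg L x.
Proof.
transitivity (\sum_(A in L) \sum_x (x \in A) * deg L x).
  apply: eq_bigr => A _; under [RHS]eq_bigr => x _ do rewrite big_distrr /=.
  rewrite exchange_big; apply: eq_bigr => B _ /=.
  rewrite -sum1_card big_mkcond; apply: eq_bigr => x _.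
  by rewrite inE mulnb; case: (_ && _).
by rewrite exchange_big; apply: eq_bigr => x _ /=; rewrite -big_distrl.
Qed.

(** The square splits into its diagonal and two open triangles, which symmetry makes equal. *)
Lemma sum_sym_ltn (n : nat) (f : 'I_n -> 'I_n -> nat) :
    (forall i j, f i j = f j i) ->
  \sum_i \sum_j f i j = (\sum_(i < n) \sum_(j < n | i < j) f i j).*2 + \sum_i f i i.
Proof.
move=> fC.
have -> : \sum_i \sum_j f i j = \sum_i (f i i
    + (\sum_(j < n | i < j) f i j + \sum_(j < n | j < i) f i j)).
  apply: eq_bigr => i _; rewrite (bigD1 i) //=; congr (_ + _).
  rewrite (bigID (fun j : 'I_n => i < j)) /=; congr (_ + _).
    by apply: eq_bigl => j; rewrite -val_eqE /=; lia.
  by apply: eq_bigl => j; rewrite -val_eqE /=; lia.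
rewrite !big_split /= addnC -addnn; congr (_ + _ + _).
rewrite (exchange_big_dep xpredT) //=; apply: eq_bigr => i _.
by apply: eq_bigr => j _; apply: fC.
Qed.

(** The sum over all ordered pairs, diagonal included, equals [\sum_x d_x ^ 2]. Removing the
    diagonal [\sum_x d_x] and halving leaves ['C(d_x, 2)] at each point. *)
Lemma Kfam_deg (m : nat) (L : {set {set 'I_m}}) :
  Kfam L = \sum_x 'C(deg L x, 2).
Proof.
pose f (i j : 'I_#|L|) := #|enum_val i :&: enum_val j|.
have /sum_sym_ltn : forall i j, f i j = f j i by move=> i j; rewrite /f setIC.
have -> : \sum_i \sum_j f i j = \sum_x deg L x * deg L x.
  rewrite -sum_cardI_deg [RHS]big_enum_val; apply: eq_bigr => i _.
  by rewrite [RHS]big_enum_val.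
have -> : \sum_i f i i = \sum_x deg L x.
  rewrite -sum_card_deg [RHS]big_enum_val; apply: eq_bigr => i _.
  by rewrite /f setIid.
have -> : \sum_x deg L x * deg L x
    = (\sum_x 'C(deg L x, 2)).*2 + \sum_x deg L x.
  rewrite -addnn -!big_split; apply: eq_bigr => x _ /=.
  by have := mul_bin_diag (deg L x) 1; rewrite bin1; nia.
rewrite -/(Kfam L); lia.
Qed.

(** The [l]-sets missing [x] are those inside [[set~ x]], so there are ['C(m - 1, l)] of them;
    Pascal's rule gives the rest. *)
Lemma deg_Iset (l m : nat) (x : 'I_m) :
  0 < l -> deg (Iset l m) x = 'C(m - 1, l - 1).
Proof.
move=> l_gt0; have m_gt0 : 0 < m by case: x => i; lia.
have card_out : \sum_(A in Iset l m) (x \notin A) = 'C(m - 1, l).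
  have <- : #|[set~ x]| = m - 1 by rewrite cardsC1 card_ord subn1.
  rewrite -cards_draws -sum1_card [LHS]big_mkcond [RHS]big_mkcond /=.
  apply: eq_bigr => A _; rewrite !inE subsetC sub1set inE.
  by case: (x \in A); case: eqP.
have : deg (Iset l m) x + \sum_(A in Iset l m) (x \notin A) = 'C(m, l).
  rewrite -[m in 'C(m, _)]card_ord -card_draws -big_split /= -sum1_card.
  by apply: eq_bigr => A _; case: (x \in A).
rewrite card_out; case: l l_gt0 {card_out} => // l _.
by case: m x m_gt0 => // m x _; rewrite !subn1 /= binS; lia.
Qed.

Lemma deg_compl (T : finType) (U L : {set {set T}}) (x : T) :
  L \subset U -> deg (U :\: L) x + deg L x = deg U x.
Proof.
move=> sLU; rewrite /deg [RHS](big_setID L) /= addnC.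
by rewrite (setIidPr sLU).
Qed.

(** To be used with [a = nu - d_x] and [b = d_x]. If [a + b = 0], the truncated difference is
    multiplied by [b = 0]. *)
Lemma bin2_compl (a b : nat) :
  'C(a, 2) + b * (a + b - 1) = 'C(a + b, 2) + 'C(b, 2).
Proof.
have bin2E n : 'C(n, 2).*2 = n * (n - 1).
  by have := mul_bin_diag n 1; rewrite bin1 -subn1; lia.
have := bin2E a; have := bin2E b; have := bin2E (a + b); nia.
Qed.

(** The negative term is moved to the left to stay in [nat]; [bin2_compl] is then summed over the
    points. *)
Lemma Kfam_compl (l m : nat) (L : {set {set 'I_m}}) :
    0 < l -> L \subset Iset l m ->
  let nu := 'C(m - 1, l - 1) in
  Kfam (Iset l m :\: L) + #|L| * l * (nu - 1) = m * 'C(nu, 2) + Kfam L.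
Proof.
move=> l_gt0 sL nu; rewrite !Kfam_deg.
have -> : #|L| * l = \sum_x deg L x.
  rewrite -sum_card_deg -sum_nat_const; apply: eq_bigr => A AL.
  by have := subsetP sL A AL; rewrite inE => /eqP.
have -> : m * 'C(nu, 2) = \sum_(x < m) 'C(nu, 2).
  by rewrite sum_nat_const card_ord.
rewrite big_distrl -!big_split; apply: eq_bigr => x _ /=.
by rewrite /nu -(deg_Iset x l_gt0) -(deg_compl x sL) bin2_compl.
Qed.

Lemma card_Iset (l m : nat) : #|Iset l m| = 'C(m, l).
Proof. by rewrite card_draws card_ord. Qed.

Lemma card_Iset_compl (l m : nat) (L : {set {set 'I_m}}) :
  L \subset Iset l m -> #|Iset l m :\: L| = 'C(m, l) - #|L|.
Proof. by move=> sL; rewrite cardsD (setIidPr sL) card_Iset. Qed.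

Lemma Kfam_le_Kmax (l m : nat) (L : {set {set 'I_m}}) :
  L \subset Iset l m -> Kfam L <= Kmax l m #|L|.
Proof. by move=> sL; apply: leq_bigmax_cond; rewrite sL eqxx. Qed.

Lemma Kmax_attained (l m r : nat) : r <= 'C(m, l) ->
  exists L : {set {set 'I_m}}, [/\ L \subset Iset l m, #|L| = r
    & Kmax l m r = Kfam L].
Proof.
rewrite -card_Iset => le_r.
have nonempty : 0 < #|[pred L : {set {set 'I_m}} |
    (L \subset Iset l m) && (#|L| == r)]|.
  have := cards_draws (Iset l m) r; rewrite cardsE => ->.
  by rewrite bin_gt0.
have [L /andP[sL /eqP cL] KL] := eq_bigmax_cond (@Kfam m) nonempty.
by exists L; split.
Qed.

Lemma Kmax_compl (l m r : nat) : 0 < l -> r <= 'C(m, l) ->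
  let nu := 'C(m - 1, l - 1) in
  Kmax l m ('C(m, l) - r) + r * l * (nu - 1) = m * 'C(nu, 2) + Kmax l m r.
Proof.
move=> l_gt0 le_r nu; apply/eqP; rewrite eqn_leq.
apply/andP; split.
  (* Upper bound: the complement of an optimal family of size [k - r] competes in the maximum for
     [r], and its own complement is [L] again. *)
  have [L [sL cL ->]] := Kmax_attained (leq_subr r 'C(m, l)).
  have sLc : Iset l m :\: L \subset Iset l m := subsetDl _ _.
  have cLc : #|Iset l m :\: L| = r by rewrite card_Iset_compl // cL subKn.
  have := Kfam_compl l_gt0 sLc; have := Kfam_le_Kmax sLc.
  by rewrite /= setDDr setDv set0U (setIidPr sL) cLc -/nu; lia.
(* Lower bound: the complement of an optimal family of size [r] competes in the maximum for
   [k - r]. *)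
have [L [sL cL ->]] := Kmax_attained le_r.
have := Kfam_compl l_gt0 sL; have := Kfam_le_Kmax (subsetDl (Iset l m) L).
by rewrite /= card_Iset_compl // cL -/nu; lia.
Qed.

Local Open Scope ring_scope.

Theorem proposition9 (l m : nat) (hl : (1 <= l)%N) (hlm : (l <= m)%N) :
  let k := 'C(m, l) in
  let nu := 'C(m - 1, l - 1) in
  (forall L : {set {set 'I_m}}, L \subset Iset l m ->
     let Lc := Iset l m :\: L in
     let r := #|L| in
     (subclose l L <-> subclose l Lc) /\
     (Kfam Lc)%:Z
       = m%:Z * 'C(nu, 2)%:Z - r%:Z * l%:Z * (nu%:Z - 1) + (Kfam L)%:Z) /\
  (forall r : nat, (r <= k)%N ->
     (Kmax l m (k - r))%:Z
       = m%:Z * 'C(nu, 2)%:Z - r%:Z * l%:Z * (nu%:Z - 1) + (Kmax l m r)%:Z).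
Proof.
move=> k nu.
(* Positivity of [nu] makes [nu - 1] in [nat] agree with the integer difference. *)
have nu_gt0 : (0 < nu)%N by rewrite bin_gt0 leq_sub2r.
have toZ (a b r : nat) : (a + r * l * (nu - 1) = m * 'C(nu, 2) + b)%N ->
    a%:Z = m%:Z * 'C(nu, 2)%:Z - r%:Z * l%:Z * (nu%:Z - 1) + b%:Z.
  move/(congr1 Posz); rewrite !PoszD !PoszM -subzn // => e.
  by rewrite addrAC -e addrK.
split=> [L sL Lc r|r le_r]; last exact/toZ/Kmax_compl.
have le_r : (r <= k)%N by rewrite /k -card_Iset subset_leq_card.
have cLc : #|Lc| = (k - r)%N by rewrite card_Iset_compl.
have KL := Kfam_compl hl sL; have KM := Kmax_compl hl le_r.
split; last exact: toZ.
rewrite /subclose cLc -/r; have sLc : Lc \subset Iset l m := subsetDl _ _.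
rewrite /= -/nu -/k -/Lc -/r in KL KM.
(* By [KL] and [KM], passing to complements shifts the value and the maximum by the same amount, so
   equality holds for both families or for neither. *)
by split=> -[_ E]; split=> //; lia.
Qed.
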